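(* For every $n\ge 3$, the cycle $C_n$ on $n$ vertices satisfies $\gamma^{p}_{I}(C_n)=\left\lceil\frac{n}{2}\right\rceil$.
   Context: All graphs are finite and simple. A perfect Italian dominating function (PID-function) of a graph $G$ is a function $f:V(G)\to\{0,1,2\}$ such that for every vertex $v$ with $f(v)=0$ we have $\sum_{u\in N(v)}f(u)=2$, where $N(v)$ is the open neighborhood of $v$. Its weight is $\sum_{u\in V(G)}f(u)$. The perfect Italian domination number $\gamma^{p}_{I}(G)$ is the minimum weight of a PID-function of $G$. *)

(* Defs.v *)
From mathcomp Require Import all_boot.

Set Implicit Arguments.
Unset Strict Implicit.
Unset Printing Implicit Defensive.

Record sgraph := SGraph {
  vertex :> finType;
  adj : rel vertex;
  adj_sym : symmetric adj;
  adj_irrefl : irreflexive adj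
}.

Definition open_nbh (G : sgraph) (v : G) : {set G} := [set u | adj v u].

(* 'I_3 is the set of labels {0, 1, 2}; labels are summed as natural numbers. *)
Definition PID_function (G : sgraph) (f : {ffun G -> 'I_3}) : bool :=
  [forall v : G,
     ((f v : nat) == 0) ==> (\sum_(u in open_nbh v) (f u : nat) == 2)].

Definition weight (G : sgraph) (f : {ffun G -> 'I_3}) : nat :=
  \sum_(u : G) (f u : nat).

Definition PID_weight (G : sgraph) : pred nat :=
  fun w => [exists f : {ffun G -> 'I_3}, PID_function f && (weight f == w)].

Lemma ex_PID_weight (G : sgraph) : exists w, PID_weight G w.
Proof.
pose f : {ffun G -> 'I_3} := [ffun => Ordinal (isT : 1 < 3)].
exists (weight f); apply/existsP; exists f; rewrite eqxx andbT.
by apply/forallP => v; rewrite ffunE.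
Qed.

Definition perfect_italian_number (G : sgraph) : nat :=
  ex_minn (ex_PID_weight G).

(* ordS is the successor modulo n on 'I_n. The conjunct i != j only matters  *)
(* for n = 1, where it excludes a loop.                                      *)
Definition cycle_adj (n : nat) : rel 'I_n :=
  fun i j => (i != j) && ((j == ordS i) || (i == ordS j)).

Lemma cycle_adj_sym (n : nat) : symmetric (@cycle_adj n).
Proof. by move=> i j; rewrite /cycle_adj eq_sym orbC. Qed.

Lemma cycle_adj_irrefl (n : nat) : irreflexive (@cycle_adj n).
Proof. by move=> i; rewrite /cycle_adj eqxx. Qed.

Definition cycle_graph (n : nat) : sgraph :=
  SGraph (@cycle_adj_sym n) (@cycle_adj_irrefl n).

(* Main.v *)
(* Lower bound: every vertex v satisfies 2 <= f (v-1) + 2 f v + f (v+1), by the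
   PID condition if f v = 0 and trivially otherwise; summing over the cycle
   gives 2 n <= 4 w.  Upper bound: put 1 on the even vertices 0, 2, 4, ... and 0
   on the odd ones.  When n is odd the two adjacent vertices n-1 and 0 both
   carry 1, and an odd vertex still has two even neighbors. *)
Require Import Defs.
From mathcomp Require Import all_boot zify.

Set Implicit Arguments.
Unset Strict Implicit.
Unset Printing Implicit Defensive.

Lemma ordS_neq n (v : 'I_n) : 1 < n -> ordS v != v.
Proof.
move=> n_gt1; apply/eqP => /(congr1 val) /=.
have := ltn_ord v; case: (ltngtP v.+1 n) => [lt_vn|//|eq_vn] _.
  by rewrite modn_small //; lia.
by rewrite eq_vn modnn; lia.
Qed.

(** This makes the two neighbors of a vertex distinct, so neither is counted twice in a neighborhood
    sum. *)
Lemma ordS2_neq n (v : 'I_n) : 2 < n -> ordS (ordS v) != v.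
Proof.
move=> n_gt2; apply/eqP => /(congr1 val) /=; rewrite -addn1 modnDml addn1.
have := ltn_ord v; case: (ltnP v.+2 n) => [lt_vn|le_nv] lt_vn'.
  by rewrite modn_small //; lia.
(* Wrapping around once leaves [v.+2 - n], which equals [v] only if [n] is 2. *)
have -> : v.+2 = v.+2 - n + n by lia.
by rewrite modnDr modn_small; lia.
Qed.

Lemma open_nbh_cycle n (v : 'I_n) :
  1 < n -> open_nbh (v : cycle_graph n) = [set ord_pred v; ordS v].
Proof.
move=> n_gt1; apply/setP => u; rewrite !inE /= /cycle_adj orbC.
have -> : (v == ordS u) = (u == ord_pred v).
  by rewrite -(inj_eq (@ordS_inj n) u) ord_predK eq_sym.
apply: andb_idl => /orP[] /eqP ->; last by rewrite eq_sym ordS_neq.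
by rewrite -{1}(ord_predK v) ordS_neq.
Qed.

Lemma sum_open_nbh_cycle n (v : 'I_n) (F : 'I_n -> nat) :
  2 < n ->
  \sum_(u in open_nbh (v : cycle_graph n)) F u = F (ord_pred v) + F (ordS v).
Proof.
move=> n_gt2; rewrite open_nbh_cycle ?(ltnW n_gt2) // big_setU1 ?big_set1 //=.
apply/negP => /set1P eq_pS; case/eqP: (ordS2_neq v n_gt2).
by rewrite -eq_pS ord_predK.
Qed.

Lemma PID_weight_cycle_geq n (f : {ffun cycle_graph n -> 'I_3}) :
  2 < n -> PID_function f -> n <= (weight f).*2.
Proof.
move=> n_gt2 /forallP PIDf; pose F (i : 'I_n) : nat := f i.
(* Both shifts permute the vertices, so the shifted sums keep the weight. *)
have sumS : \sum_i F (ordS i) = weight f.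
  exact/esym/(reindex_inj (@ordS_inj n)).
have sumP : \sum_i F (ord_pred i) = weight f.
  exact/esym/(reindex_inj (@ord_pred_inj n)).
have : \sum_(i < n) 2 <= \sum_i (F (ord_pred i) + F (ordS i) + (F i + F i)).
  apply: leq_sum => i _; have := PIDf i; rewrite (sum_open_nbh_cycle i F) // /F.
  by case: (f i : nat) => [/eqP -> //|m _]; lia.
rewrite sum_nat_const card_ord !big_split /= sumS sumP.
by rewrite -/(weight f); lia.
Qed.

Definition even_label n : {ffun cycle_graph n -> 'I_3} :=
  [ffun i : 'I_n => inord (~~ odd i)].

Lemma even_labelE n (i : 'I_n) : even_label n i = ~~ odd i :> nat.
Proof. by rewrite ffunE inordK //; case: odd. Qed.

Lemma PID_even_label n : 2 < n -> PID_function (even_label n).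
Proof.
move=> n_gt2; apply/forallP => v; apply/implyP; rewrite even_labelE.
rewrite eqb0 negbK => odd_v.
rewrite (sum_open_nbh_cycle v (fun i => even_label n i)) // !even_labelE /=.
have lt_vn := ltn_ord v.
(* Since [v] is odd, it is positive and its predecessor does not wrap around. *)
have -> : (v + n).-1 %% n = v.-1.
  have -> : (v + n).-1 = v.-1 + n by lia.
  by rewrite modnDr modn_small; lia.
(* The successor of [v] is even even when it wraps around, since it is then 0. *)
have -> : odd (v.+1 %% n) = false.
  case: (ltngtP v.+1 n) => [lt_Svn|gt_Svn|->]; last by rewrite modnn.
    by rewrite modn_small //= odd_v.
  by lia.
by lia.
Qed.

Lemma weight_even_label n : weight (even_label n) = uphalf n.
Proof.
rewrite /weight; under eq_bigr do rewrite even_labelE.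
(* The summand [~~ odd i] no longer depends on [n], so the last vertex can be split off. *)
by elim: n => [|n IHn]; rewrite ?big_ord0 // big_ord_recr /= IHn; lia.
Qed.

Theorem theorem2p5 (n : nat) (hn : 3 <= n) :
  perfect_italian_number (cycle_graph n) = uphalf n.
Proof.
rewrite /perfect_italian_number; case: ex_minnP => w /existsP[f].
case/andP=> PIDf /eqP <- min_w; apply/eqP; rewrite eqn_leq; apply/andP; split.
  apply: min_w; apply/existsP; exists (even_label n).
  by rewrite PID_even_label // weight_even_label eqxx.
by rewrite leq_uphalf_double PID_weight_cycle_geq.
Qed.
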